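(* Let $G$ be a finitely generated nilpotent group whose torsion subgroup $T$ is non-trivial and has odd order. Then every finite conjugacy class $\mathcal{O}$ of $G$, regarded as a rack with $x\triangleright y=xyx^{-1}$, is either abelian or else of type C.
   Context: A rack is a non-empty set $X$ with a self-distributive operation $\triangleright:X\times X\to X$ such that $\varphi_x:=x\triangleright\underline{\ \ }$ is bijective for every $x\in X$. A rack $X$ is abelian if $x\triangleright y=y$ for all $x,y\in X$. For a rack $Y$, $\operatorname{Inn}Y$ is the subgroup of the group of rack automorphisms of $Y$ generated by all $\varphi_y$, $y\in Y$, and $\mathcal{O}^{\operatorname{Inn}Y}_{r}$ denotes the orbit of $r\in Y$ under $\operatorname{Inn}Y$. A rack $Y$ is decomposable if it is a disjoint union $Y=R\coprod S$ of two non-empty subracks with $R\triangleright S=S$ and $S\triangleright R=R$. A finite rack $X$ is of type C when there are a decomposable subrack $Y=R\coprod S$ of $X$ and elements $r\in R$, $s\in S$ such that: (1) $r\triangleright s\neq s$ (hence $s\triangleright r\neq r$); (2) $R=\mathcal{O}^{\operatorname{Inn}Y}_{r}$ and $S=\mathcal{O}^{\operatorname{Inn}Y}_{s}$; (3) $\min\{|R|,|S|\}>2$ or $\max\{|R|,|S|\}>4$. The torsion subgroup of a finitely generated nilpotent group is the (finite) subgroup of its elements of finite order. *)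

(* Defs.v *)
From HB Require Import structures.
From mathcomp Require Import all_boot fingroup perm action finmap.
From mathcomp Require Import boolp classical_sets cardinality.

Set Implicit Arguments.
Unset Strict Implicit.
Unset Printing Implicit Defensive.

Reserved Notation "x ▷ y" (at level 40, no associativity).

HB.mixin Record isRack X := {
  rop : X -> X -> X;
  rack_inhabited : inhabited X;
  ropD : forall x y z, rop x (rop y z) = rop (rop x y) (rop x z);
  rop_bij : forall x, bijective (rop x)
}.

#[short(type="rackType")]
HB.structure Definition Rack := {X of isRack X}.

#[short(type="finRackType")]
HB.structure Definition FinRack := {X of isRack X & Finite X}.

Notation "x ▷ y" := (rop x y).

Definition rack_abelian (X : rackType) : Prop := forall x y : X, x ▷ y = y.

Section FinRackTheory.
Variable X : finRackType.
Implicit Types (x y : X) (Y R S : {set X}).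

Lemma rop_inj x : injective (rop x).
Proof. exact: bij_inj (rop_bij x). Qed.

Definition inner x : {perm X} := perm (@rop_inj x).

Definition rack_Aut : {set {perm X}} :=
  [set p : {perm X} | [forall x, forall y, p (x ▷ y) == p x ▷ p y]].

Definition Inn : {set {perm X}} := <<[set inner x | x : X]>>%g.

Canonical Inn_group := Eval hnf in [group of Inn].

Lemma rack_Aut_group_set : group_set rack_Aut.
Proof.
apply/group_setP; split.
  by rewrite inE; apply/forallP => x; apply/forallP => y; rewrite !perm1.
move=> p q; rewrite !inE => /'forall_'forall_eqP pP /'forall_'forall_eqP qP.
by apply/forallP => x; apply/forallP => y; rewrite !permM pP qP.
Qed.

Canonical rack_Aut_group := Group rack_Aut_group_set.

Lemma Inn_sub_Aut : Inn \subset rack_Aut.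
Proof.
rewrite gen_subG; apply/fintype.subsetP => _ /imsetP[x _ ->]; rewrite inE.
by apply/forallP => y; apply/forallP => z; rewrite !permE ropD.
Qed.

(* The restriction of each rop y to Y is injective because X is a rack, so it
   is a bijection of Y onto itself exactly when its image is Y. *)
Definition is_subrack Y : Prop :=
  Y != finset.set0 /\ (forall y, y \in Y -> rop y @: Y = Y).

Definition decomposition R S : Prop :=
  [/\ R :|: S = [set: X], [disjoint R & S], is_subrack R, is_subrack S
    & rop @2: (R, S) = S /\ rop @2: (S, R) = R].

End FinRackTheory.

Definition subrack_type (X : finRackType) (Y : {set X}) (hY : is_subrack Y) :
  Type := {x : X | x \in Y}.

Section SubrackType.
Variables (X : finRackType) (Y : {set X}) (hY : is_subrack Y).
Local Notation sY := (subrack_type hY).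

HB.instance Definition _ := Finite.copy sY {x : X | x \in Y}.

Lemma sub_rop_subproof (x y : {x : X | x \in Y}) : val x ▷ val y \in Y.
Proof.
by rewrite -[in X in _ \in X](hY.2 (val x) (valP x)) imset_f ?(valP y).
Qed.

Definition sub_rop (x y : sY) : sY := Sub (val x ▷ val y) (sub_rop_subproof x y).

Lemma sub_rack_inhabited : inhabited sY.
Proof. by case/set0Pn: hY.1 => x xY; exists; exists x. Qed.

Lemma sub_ropD x y z : sub_rop x (sub_rop y z) = sub_rop (sub_rop x y) (sub_rop x z).
Proof. by apply: val_inj; rewrite /= ropD. Qed.

Lemma sub_rop_bij x : bijective (sub_rop x).
Proof.
by apply: injF_bij => y z /(congr1 val)/= /rop_inj; apply: val_inj.
Qed.

HB.instance Definition _ :=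
  isRack.Build sY sub_rack_inhabited sub_ropD sub_rop_bij.

End SubrackType.

Definition rack_type_C (X : finRackType) : Prop :=
  exists (Y : {set X}) (hY : is_subrack Y) (R S : {set subrack_type hY}),
    decomposition R S /\
    exists r s : subrack_type hY,
      [/\ r \in R, s \in S,
          r ▷ s <> s,
          R = orbit 'P (Inn (subrack_type hY)) r
          /\ S = orbit 'P (Inn (subrack_type hY)) s
        & 2 < minn #|R| #|S| \/ 4 < maxn #|R| #|S|].

Local Open Scope group_scope.
Local Open Scope classical_set_scope.

Section Groups.
Variable G : groupType.
Implicit Types (x y : G) (A H : set G).

Definition is_subgroup H : Prop := group_closed (mem H).

Definition subgroup_generated A : set G := smallest is_subgroup A.

Definition finitely_generated : Prop :=
  exists s : seq G, subgroup_generated [set` s] = setT.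

Fixpoint lower_central (n : nat) : set G :=
  if n is m.+1 then
    subgroup_generated [set [~ x, y] | x in lower_central m & y in setT]
  else setT.

Definition group_nilpotent : Prop := exists n, lower_central n = [set 1].

Definition torsion : set G := [set x | exists2 n : nat, (0 < n)%N & x ^+ n = 1].

Definition conj_class x : set G := [set g * x * g^-1 | g in setT].

End Groups.

Arguments finitely_generated : clear implicits.
Arguments lower_central : clear implicits.
Arguments group_nilpotent : clear implicits.
Arguments torsion : clear implicits.

Definition class_type (G : groupType) (x : G) (O : {fset G})
  (hO : [set` O] = conj_class x) : Type := O.

Section ClassRack.
Variables (G : groupType) (x : G) (O : {fset G}).
Hypothesis hO : [set` O] = conj_class x.
Local Notation cO := (class_type hO).

HB.instance Definition _ := Finite.copy cO O.

Lemma class_rop_subproof (y z : O) : val y * val z * (val y)^-1 \in O.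
Proof.
have [g _ zE] : conj_class x (val z) by rewrite -hO; exact: valP.
have : conj_class x (val y * val z * (val y)^-1).
  by exists (val y * g) => //; rewrite -zE invgM !mulgA.
by rewrite -hO.
Qed.

Definition class_rop (y z : cO) : cO :=
  Sub (val (y : O) * val (z : O) * (val (y : O))^-1) (class_rop_subproof y z).

Lemma class_rack_inhabited : inhabited cO.
Proof.
have : conj_class x x by exists 1 => //; rewrite mul1g invg1 mulg1.
by rewrite -hO => xO; exists; exact: (Sub x xO : O).
Qed.

Lemma class_ropD y z t :
  class_rop y (class_rop z t) = class_rop (class_rop y z) (class_rop y t).
Proof.
by apply: val_inj; rewrite /= !invgM invgK !mulgA !mulgKV.
Qed.

Lemma class_rop_bij y : bijective (class_rop y).
Proof.
apply: injF_bij => z t /(congr1 val)/= /mulIg /mulgI; exact: val_inj.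
Qed.

HB.instance Definition _ :=
  isRack.Build cO class_rack_inhabited class_ropD class_rop_bij.

End ClassRack.

(* Main.v *)
Require Import Defs.
From mathcomp Require Import all_boot fingroup perm action finmap.
From mathcomp Require Import boolp classical_sets cardinality.

Local Open Scope classical_set_scope.
Local Open Scope group_scope.

(* Let [y], [z] be non-commuting elements of the class and let R, S be their
   conjugacy classes in H = <y, z>; the subrack is Y = R U S, on which Inn Y
   acts through H.  If y were conjugate to z in H, then H would be cyclic modulo
   its derived subgroup, hence cyclic by nilpotency; so R and S are disjoint.
   If R had two elements, conjugation by z would swap y and y' = z y z^-1, so it
   would invert u = y^-1 y'; by nilpotency u would then have 2-power order,
   which is impossible for u <> 1 as |T| is odd.  Hence |R|, |S| > 2. *)

(** * Subgroups and the lower central series *)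

Lemma is_subgroupP (G : groupType) (H : set G) :
  is_subgroup H <-> H 1 /\ (forall x y, H x -> H y -> H (x / y)).
Proof.
have memH x : (x \in mem H) = (x \in H) by [].
rewrite /is_subgroup /group_closed /divg_closed memH in_setE.
split=> -[H1 HB]; split=> //.
  by move=> x y Hx Hy; rewrite -[H _]in_setE; apply: HB; rewrite memH in_setE.
by move=> x y; rewrite !memH !in_setE; apply: HB.
Qed.

Lemma subgroup_generatedP (G : groupType) (A : set G) :
  is_subgroup (subgroup_generated A).
Proof.
apply/is_subgroupP; split=> [H [/is_subgroupP[]//]|x y Ax Ay H HA].
have [/is_subgroupP[_ HB] _] := HA.
by apply: HB; [apply: Ax|apply: Ay].
Qed.

Lemma lower_central_subgroup (G : groupType) n :
  is_subgroup (lower_central G n).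
Proof.
by case: n => [|n]; [apply/is_subgroupP|apply: subgroup_generatedP].
Qed.

Lemma lower_central1 (G : groupType) n : lower_central G n 1.
Proof. by have /is_subgroupP[] := @lower_central_subgroup G n. Qed.

Lemma lower_centralV (G : groupType) n (x : G) :
  lower_central G n x -> lower_central G n x^-1.
Proof.
have /is_subgroupP[H1 HB] := @lower_central_subgroup G n.
by rewrite -[x^-1]mul1g; apply: HB.
Qed.

Lemma lower_centralM (G : groupType) n (x y : G) :
  lower_central G n x -> lower_central G n y -> lower_central G n (x * y).
Proof.
have /is_subgroupP[_ HB] := @lower_central_subgroup G n.
by move=> Hx /lower_centralV Hy; rewrite -[y]invgK; apply: HB.
Qed.

Lemma lower_centralR (G : groupType) n (x y : G) :
  lower_central G n x -> lower_central G n.+1 [~ x, y].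
Proof. by move=> Hx; apply: sub_gen_smallest; exists x => //; exists y. Qed.

Lemma lower_centralS (G : groupType) n :
  lower_central G n.+1 `<=` lower_central G n.
Proof.
elim: n => // n IHn; apply: sub_smallest2r; first exact: subgroup_generatedP.
by move=> _ [x Hx [y _ <-]]; exists x; [apply: IHn|exists y].
Qed.

Lemma lower_centralJ (G : groupType) n (x y : G) :
  lower_central G n x -> lower_central G n (x ^ y).
Proof.
move=> Hx; have -> : x ^ y = x * [~ x, y] by rewrite commgEl mulKVg.
by apply: lower_centralM => //; apply: lower_centralS; apply: lower_centralR.
Qed.

(** If [z] inverts [v], then [[~ v, z]] is [v ^- 2], so each squaring descends one step in the
    series. *)
Lemma lower_central_sqr (G : groupType) (u z : G) n :
  u ^ z = u^-1 -> lower_central G n (u ^+ (2 ^ n)).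
Proof.
move=> uz; elim: n => // n IHn; set v := u ^+ (2 ^ n) in IHn.
have vz : v ^ z = v^-1 by rewrite conjXg uz expVgn.
have -> : u ^+ (2 ^ n.+1) = [~ v, z]^-1.
  by rewrite commgEl vz invgM !invgK expnSr expgM expgS expg1.
by apply: lower_centralV; apply: lower_centralR.
Qed.

(** The commutator [u = [~ y, z]] is inverted by [z], so nilpotency kills some [u ^+ (2 ^ n)];
    square roots of 1 being trivial, [u = 1]. *)
Lemma nilpotent_commute_sqr (G : groupType) (y z : G) :
  group_nilpotent G -> (forall w : G, w ^+ 2 = 1 -> w = 1) ->
  (y ^ z) ^ z = y -> y ^ z = y.
Proof.
move=> [n Gn] G2 yzz; apply/conjg_fixP/eqP; set u := [~ y, z].
have uz : u ^ z = u^-1.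
  by rewrite /u commgEl conjMg yzz conjVg [RHS]invgM invgK.
have : u ^+ (2 ^ n) = 1.
  by have := @lower_central_sqr G u z n uz; rewrite Gn.
elim: n {Gn} => // n IHn; rewrite expnSr expgM => /G2; exact: IHn.
Qed.

(* Applied to the conjugacy class of [z] in the subgroup generated by [y] and
   [z]: modulo a term of the lower central series containing [z^-1 y], both
   generators commute with [z] one step further down. *)
Lemma nilpotent_conj_generator (G : groupType) (y z : G) :
  group_nilpotent G ->
  (forall P : set G, P z -> (forall t, P t -> P (t ^ y^-1)) ->
     (forall t, P t -> P (t ^ z^-1)) -> P y) ->
  y = z.
Proof.
move=> [n Gn] zPy; suff : lower_central G n (z^-1 * y).
  by rewrite Gn => /(canRL (mulKVg z)); rewrite mulg1.
elim: n {Gn} => // n IHn.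
have step g t : lower_central G n.+1 [~ z, g] ->
    lower_central G n.+1 (z^-1 * t) -> lower_central G n.+1 (z^-1 * t ^ g).
  have -> : z^-1 * t ^ g = [~ z, g] * (z^-1 * t) ^ g.
    by rewrite commgEl conjMg conjVg -mulgA mulVKg.
  by move=> Hg Ht; apply: lower_centralM => //; apply: lower_centralJ.
apply: (zPy [set t | lower_central G n.+1 (z^-1 * t)]).
- by rewrite /mkset mulVg; apply: lower_central1.
- move=> t; apply: step.
  (* As [y^-1] is [(z^-1 * y)^-1 * z^-1], its commutator with [z] can be carried by [z^-1 * y],
     which [IHn] controls. *)
  have -> : [~ z, y^-1] = [~ (z^-1 * y)^-1, z^-1].
    by rewrite !commgEl !conjgE !invgM !invgK !mulgA mulgK.
  by apply: lower_centralR; apply: lower_centralV.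
- by move=> t; apply: step; rewrite commgVg; apply: lower_central1.
Qed.

(** * Odd torsion excludes involutions *)

Lemma involution_card_even (T : finType) (f : T -> T) :
  involutive f -> (forall x, f x != x) -> ~~ odd #|T|.
Proof.
move=> fK fN; have f_inj := inv_inj fK.
have ord2 x : fingraph.order f x = 2.
  apply: (@order_cycle _ _ [:: x; f x]); last by rewrite inE eqxx.
    by rewrite /= fK !eqxx.
  by rewrite /= inE eq_sym fN.
(* All cycles of [f] have length 2, so the cardinality is twice their number. *)
rewrite -cardsT -(@fcard_order_set T f f_inj 2 [set: T]%SET).
- by rewrite oddM andbF.
- by apply/fintype.subsetP => x _; rewrite inE /= ord2.
- by move=> x y _; rewrite !inE.
Qed.

(* If [w] is an involution, [t |-> w t] on the centraliser of [w] and
   [t |-> w t w^-1] elsewhere is an involution without fixed points. *)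
Lemma odd_torsion_sqr (G : groupType) (n : nat) :
  odd n -> (torsion G #= `I_n)%card -> forall w : G, w ^+ 2 = 1 -> w = 1.
Proof.
move=> n_odd Tn w w2; apply: contrapT => w1.
have Tfin : finite_set (torsion G) by apply/finite_setP; exists n.
set T := fset_set (torsion G); have cardT : #|` T| = n := card_fset_set Tn.
have inT t : (t \in T) <-> torsion G t by rewrite in_fset_set// in_setE.
have ww : w * w = 1 by rewrite -[RHS]w2 expgS expg1.
pose g t := if t ^ w == t then w * t else t ^ w.
have gT t : t \in T -> g t \in T.
  move=> /inT[k k0 tk]; apply/inT; rewrite /g; case: eqP => [tw|_].
    exists (2 * k)%N; first by rewrite muln_gt0.
    have wt : commute w t by apply: commute_sym; rewrite /commute conjgC tw.
    by rewrite expgMn// expgM w2 expg1n mul1g mulnC expgM tk expg1n.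
  by exists k => //; rewrite -conjXg tk conj1g.
have gK : involutive g.
  move=> t; rewrite /g; case: (eqVneq (t ^ w) t) => [tw|tw].
    by rewrite conjMg tw conjgE mulKg eqxx mulgA ww mul1g.
  by rewrite -conjgM ww conjg1 eq_sym (negPf tw).
have gN t : g t != t.
  rewrite /g; case: (eqVneq (t ^ w) t) => // _.
  by apply/eqP => /(canRL (mulgK t)); rewrite mulgV.
(* The default value of [insubd] is never taken, by [gT]. *)
pose f (t : T) : T := insubd t (g (val t)).
have fE t : val (f t) = g (val t) by rewrite val_insubd (gT _ (valP t)).
have : ~~ odd #|{: T}|.
  apply: (@involution_card_even _ f) => t; last by rewrite -val_eqE fE gN.
  by apply: val_inj; rewrite !fE gK.
by rewrite -cardfE cardT n_odd.
Qed.

(** * Orbits under groups generated by inner automorphisms *)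

Section GeneratedOrbits.
Variable X : finRackType.
Implicit Types (x y z : X) (B : {pred X}) (P : {set X}).

Lemma rop_stable x P : (forall p, p \in P -> x ▷ p \in P) -> rop x @: P = P.
Proof.
move=> xP; apply/eqP; rewrite eqEcard card_imset; last exact: rop_inj.
rewrite leqnn andbT; apply/fintype.subsetP => _ /imsetP[p pP ->].
exact: xP.
Qed.

(** An induction principle on orbits: finiteness turns stability under each [b] into
    [rop b @: P = P], which covers inverses as well. *)
Lemma orbit_inner_sub B P x :
  (forall b p, b \in B -> p \in P -> b ▷ p \in P) -> x \in P ->
  orbit 'P <<inner (X:=X) @: B>> x \subset P.
Proof.
move=> BP xP; rewrite acts_sub_orbit// gen_subG.
apply/fintype.subsetP => _ /imsetP[b bB ->]; apply/astabsP => p /=.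
have bP : rop b @: P = P by apply: rop_stable => q; apply: BP.
by rewrite apermE permE -{1}bP mem_imset//; exact: rop_inj.
Qed.

Lemma orbit_inner_rop B b x p : inner b \in <<inner (X:=X) @: B>> ->
  p \in orbit 'P <<inner (X:=X) @: B>> x ->
  b ▷ p \in orbit 'P <<inner (X:=X) @: B>> x.
Proof.
move=> bB /orbitP[a aA <-]; have -> : b ▷ 'P%act x a = 'P%act x (a * inner b).
  by rewrite actM /= !apermE permE.
by apply/mem_orbit/groupM.
Qed.

(* For a rack automorphism [a], [inner (a b) = a^-1 * inner b * a]. *)
Lemma inner_orbit_mem B b x : b \in B ->
  x \in orbit 'P <<inner (X:=X) @: B>> b -> inner x \in <<inner (X:=X) @: B>>.
Proof.
move=> bB /orbitP[a aA <-].
have /(fintype.subsetP (Inn_sub_Aut X)) : a \in Inn X.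
  apply: fintype.subsetP aA; apply/genS/fintype.subsetP => _ /imsetP[c _ ->].
  exact: imset_f.
rewrite inE => /'forall_'forall_eqP aM.
have -> : inner ('P%act b a) = inner b ^ a.
  apply/permP => t; rewrite -[t](permKV a) permJ !permE.
  by rewrite aM.
by apply: groupJ => //; apply/mem_gen/imset_f.
Qed.

End GeneratedOrbits.

(** The group [A] generated by the two inner automorphisms plays the role of [H]; its orbits of [y]
    and [z] give [R] and [S]. *)
Lemma rack_type_C_criterion (X : finRackType) (y z : X) :
  y \notin orbit 'P <<inner (X:=X) @: [set y; z]%SET>> z ->
  z ▷ (z ▷ y) != y -> y ▷ (y ▷ z) != z -> rack_type_C X.
Proof.
set B := [set y; z]%SET; set A := <<_>> => yNz zzy yyz.
pose Y := (orbit 'P A y :|: orbit 'P A z)%SET.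
have innerA x : x \in Y -> inner x \in A.
  by rewrite inE => /orP[]; apply: inner_orbit_mem; rewrite !inE eqxx ?orbT.
have YA x p u : x \in Y -> p \in orbit 'P A u -> x ▷ p \in orbit 'P A u.
  by move=> /innerA; apply: orbit_inner_rop.
have yY : y \in Y by rewrite inE orbit_refl.
have zY : z \in Y by rewrite inE orbit_refl orbT.
have hY : is_subrack Y.
  split; first by apply/set0Pn; exists y.
  move=> x xY; apply: rop_stable => p.
  by rewrite [in X in X -> _]inE => /orP[] /(YA _ _ _ xY);
    rewrite inE => ->; rewrite ?orbT.
pose sY := subrack_type hY.
pose O (u : X) : {set sY} := [set r : sY | val r \in orbit 'P A u]%SET.
have OA (t r : sY) u : r \in O u -> t ▷ r \in O u.
  by rewrite !inE => ru; apply: YA ru; apply: valP.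
have Osub u : u \in Y -> is_subrack (O u).
  move=> uY; split; last by move=> t _; apply/rop_stable => r; apply: OA.
  by apply/set0Pn; exists (Sub u uY); rewrite inE /= orbit_refl.
have Orop u v : u \in Y -> rop @2: (O u, O v) = O v.
  move=> /Osub[/set0Pn[t tu] _]; apply/setP => r; apply/imset2P/idP.
    by move=> [t' r' _ rv ->]; apply: OA.
  rewrite -{1}(@rop_stable _ t (O v)) => [/imsetP[r' rv ->]|r' /OA//].
  by exists t r'.
(* One inclusion holds since [O] is stable under all of [sY], the other since the [Inn sY]-orbit,
   viewed in [X], is stable under [y] and [z]. *)
have Oorb (u : sY) : O (val u) = orbit 'P (Inn sY) u.
  apply/eqP; rewrite finset.eqEsubset; apply/andP; split; last first.
    by apply: orbit_inner_sub => [t r _|]; [apply: OA|rewrite inE orbit_refl].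
  apply/fintype.subsetP => r; rewrite inE -(mem_imset _ _ val_inj).
  apply: fintype.subsetP; apply: orbit_inner_sub; last first.
    by rewrite imset_f ?orbit_refl.
  move=> b _ bB /imsetP[q qu ->].
  have bY : b \in Y.
    by move: bB; rewrite !inE => /orP[]/eqP->; rewrite orbit_refl ?orbT.
  have -> : b ▷ val q = val ((Sub b bY : sY) ▷ q) by [].
  by apply/imset_f/orbit_inner_rop => //; apply/mem_gen/imset_f.
(* Three distinct elements are [u], [v ▷ u] and [v ▷ (v ▷ u)]. *)
have Ocard (u v : sY) : val v ▷ (val v ▷ val u) != val u -> 2 < #|O (val u)|.
  move=> vvu; have uu : u \in O (val u) by rewrite inE orbit_refl.
  apply/card_gt2P; exists u, (v ▷ u), (v ▷ (v ▷ u)); rewrite !OA//.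
  have vu : u != v ▷ u.
    by apply: contraNneq vvu => /(congr1 val) /= e; rewrite -!e.
  by rewrite (inj_eq (@rop_inj _ v)).
pose y' : sY := Sub y yY; pose z' : sY := Sub z zY.
exists Y, hY, (O y), (O z); split.
  split; [| |exact: Osub|exact: Osub|by rewrite !Orop].
  - by apply/setP => r; rewrite !inE; have := valP r; rewrite inE.
  - apply/pred0P => r /=; rewrite !inE; apply/negP => /andP[ry rz].
    by move: yNz; rewrite -(orbit_eqP rz) orbit_sym ry.
exists y', z'; split.
- by rewrite inE orbit_refl.
- by rewrite inE orbit_refl.
- by move=> /(congr1 val) /= yz; move: yyz; rewrite !yz eqxx.
- by rewrite -!Oorb.
- by left; rewrite leq_min (Ocard y' z')// (Ocard z' y').
Qed.

Theorem proposition2p9 (G : groupType)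
    (G_fg : finitely_generated G)
    (G_nil : group_nilpotent G)
    (T_nontrivial : torsion G <> [set 1])
    (T_odd : exists2 n : nat, odd n & (torsion G #= `I_n)%card)
    (x : G) (O : {fset G}) (hO : [set` O] = conj_class x) :
  rack_abelian (class_type hO) \/ rack_type_C (class_type hO).
Proof.
have G2 : forall w : G, w ^+ 2 = 1 -> w = 1.
  by have [n n_odd Tn] := T_odd; apply: odd_torsion_sqr n_odd Tn.
have [?|/existsNP[y /existsNP[z yz]]] := pselect (rack_abelian (class_type hO)).
  by left.
right; pose v (t : class_type hO) : G := val (t : O).
have v_inj : injective v by exact: val_inj.
(* Since [a ^ b] is [b^-1 * a * b], the rack acts through inverses. *)
have vE s t : v (s ▷ t) = v t ^ (v s)^-1 by rewrite conjgE invgK mulgA.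
have moved (s t : class_type hO) : s ▷ t <> t -> s ▷ (s ▷ t) != t.
  move=> st; apply: contra_notN st => /eqP/(congr1 v); rewrite !vE => sst.
  by apply: v_inj; rewrite vE; apply: nilpotent_commute_sqr sst.
have zy : z ▷ y <> y.
  move=> /(congr1 v); rewrite vE => /conjg_fixP/commgP/commuteV.
  rewrite invgK => /commute_sym yzC; apply/yz/v_inj.
  by rewrite vE; apply/conjg_fixP/commgP/commuteV.
apply: (@rack_type_C_criterion _ y z); [|exact: moved..].
(* Were [y] in the orbit of [z], nilpotency would force [y = z], contrary to [yz] because
   conjugation is idempotent. *)
apply/negP => yOz; suff yzE : y = z.
  by apply/yz/v_inj; rewrite yzE vE conjgE mulgV mulg1 invgK.
apply: v_inj; apply: nilpotent_conj_generator => // P Pz Py' Pz'.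
pose P' : {set class_type hO} := [set t | `[< P (v t) >]]%SET.
suff: y \in P' by rewrite !inE.
apply: fintype.subsetP yOz; apply: orbit_inner_sub; last by rewrite !inE.
by move=> b p; rewrite !inE vE => /orP[]/eqP->; [apply: Py'|apply: Pz'].
Qed.
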